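(* Let $J$ be a square in the plane $\mathbb{R}^2$, let $0\le\alpha<2$, let $\gamma>2$, and let $C_0>0$ be given. Let $\mathbf{R}^\alpha=\{R^\alpha_\ell\}_{\ell=1}^2$ be the vector of $\alpha$-fractional Riesz transforms in the plane, with convolution kernels $K^\alpha_\ell(w)=\frac{\Omega_\ell(w/|w|)}{|w|^{2-\alpha}}$, where $\Omega_\ell(w/|w|)=\frac{w_\ell}{|w|}$, $\ell=1,2$. For $\gamma$ sufficiently large, there exists a positive measure $\mu$ on $\mathbb{R}^2$, supported outside $\gamma J$ and depending only on $\alpha$ and $\gamma$ (for the given square $J$), such that the strong reversal of energy inequality $$\mathsf{E}(J,\omega)^2\,\mathrm{P}^\alpha(J,\mu)^2\le C_0\ \mathbb{E}_J^{d\omega(x)}\mathbb{E}_J^{d\omega(z)}\left|\mathbf{T}^\alpha\mu(x)-\mathbf{T}^\alpha\mu(z)\right|^2$$ fails for $\mathbf{T}^\alpha=\mathbf{R}^\alpha$, i.e. there is a locally finite positive Borel measure $\omega$ with $|J|_\omega>0$ for which this inequality is false. Moreover, $\mu$ can be chosen so that in addition, for any $M\ge1$, the same inequality fails (in the same sense, i.e. for some $\omega$) for the vector $\mathbf{T}^\alpha=\mathbf{T}^\alpha_M$.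
   Context: Here $n=2$. For a cube $J\subset\mathbb{R}^n$ (a square if $n=2$), $|J|$ is its Lebesgue measure, $c_J$ its center, $\gamma J$ the concentric cube with side length $\gamma$ times that of $J$, and $|J|_\omega=\omega(J)$. The average is $\mathbb{E}_J^{d\omega(x)}f(x)=\frac1{|J|_\omega}\int_J f(x)\,d\omega(x)$. Energy: $\mathsf{E}(J,\omega)^2=\frac{1}{|J|_\omega}\frac1{|J|_\omega}\int_J\int_J\left|\frac{x-z}{|J|^{1/n}}\right|^2d\omega(x)\,d\omega(z)$. Fractional Poisson integral: $\mathrm{P}^\alpha(J,\mu)=\int_{\mathbb{R}^n}\frac{|J|^{1/n}}{\left(|J|^{1/n}+|y-c_J|\right)^{n+1-\alpha}}\,d\mu(y)$. For an operator $T$ with convolution kernel $K$ and $\mu$ supported outside $\gamma J$, $T\mu(x)=\int K(x-y)\,d\mu(y)$ for $x\in J$. For a vector $\mathbf{T}^\alpha=\{T_\ell^\alpha\}_\ell$ of such operators, $\mathbf{T}^\alpha\mu=(T_\ell^\alpha\mu)_\ell$ and $|\cdot|$ is the Euclidean norm. For $M\ge1$, $\mathbf{T}^\alpha_M=\{T^\alpha_\Omega:\Omega\in\mathcal{P}_M\}$ with $\mathcal{P}_M=\{\cos k\theta,\sin k\theta\}_{k=1}^M$, where $T^\alpha_\Omega$ has convolution kernel $\frac{\Omega(x/|x|)}{|x|^{2-\alpha}}=\frac{\Omega(\theta)}{|x|^{2-\alpha}}$ on $\mathbb{R}^2\setminus\{0\}$, $\theta$ being the polar angle of $x$. *)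

(* Defs.v *)
From HB Require Import structures.
From mathcomp Require Import all_boot all_order all_algebra.
From mathcomp Require Import all_classical all_reals all_analysis.
Import Order.TTheory GRing.Theory Num.Theory.
Import numFieldNormedType.Exports.

Set Implicit Arguments.
Unset Strict Implicit.
Unset Printing Implicit Defensive.

Local Open Scope classical_set_scope.
Local Open Scope ring_scope.

(* The sigma-algebra carried by R * R is the product of the Borel ones, i.e.
   the Borel sigma-algebra of the plane.  The library's norm on R * R is the
   sup norm; the Euclidean one is enorm below. *)
Notation plane R := (R * R)%type.

Section Plane.
Context {R : realType}.

Definition enorm (w : plane R) : R := Num.sqrt (w.1 ^+ 2 + w.2 ^+ 2).

Definition locally_finite (mu : {measure set (plane R) -> \bar R}) : Prop :=
  forall x : plane R, exists2 U, nbhs x U & measurable U /\ (mu U < +oo)%E.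

Definition msupport (mu : {measure set (plane R) -> \bar R}) : set (plane R) :=
  [set x | forall U, open U -> U x -> (0 < mu U)%E].

(* Closed square with center c and side length s, whose sides are parallel to
   (cos t, sin t) and (- sin t, cos t). *)
Definition square_set (c : plane R) (s t : R) : set (plane R) :=
  [set x | `|(x.1 - c.1) * cos t + (x.2 - c.2) * sin t| <= s / 2 /\
           `|(x.2 - c.2) * cos t - (x.1 - c.1) * sin t| <= s / 2].

End Plane.

Record square (R : realType) := Square {
  center : plane R;
  side : R;
  tilt : R;
  side_gt0 : 0 < side }.

Section Squares.
Context {R : realType}.
Implicit Types (J : square R) (mu omega : {measure set (plane R) -> \bar R}).

Definition pts J : set (plane R) := square_set (center J) (side J) (tilt J).

Definition dilate (gamma : R) J : set (plane R) :=
  square_set (center J) (gamma * side J) (tilt J).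

Definition area J : R :=
  fine ((@lebesgue_measure R \x @lebesgue_measure R)%E (pts J)).

(* |J|^{1/n} with n = 2 *)
Definition root_area J : R := Num.sqrt (area J).

Definition avg omega J (f : plane R -> \bar R) : \bar R :=
  (((fine (omega (pts J)))^-1)%:E * \int[omega]_(x in pts J) f x)%E.

Definition energy_sq J omega : \bar R :=
  (((fine (omega (pts J)))^-1)%:E * ((fine (omega (pts J)))^-1)%:E *
   \int[omega]_(x in pts J) \int[omega]_(z in pts J)
     (((enorm (x - z)%R / root_area J) ^+ 2)%R)%:E)%E.

Definition poisson (alpha : R) J mu : \bar R :=
  (\int[mu]_y
     (root_area J / (root_area J + enorm (y - center J)) `^ (3 - alpha))%R%:E)%E.

End Squares.

Section Operators.
Context {R : realType}.
Implicit Types (J : square R) (mu omega : {measure set (plane R) -> \bar R}).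

Definition frac_kernel (alpha : R) (Omega : plane R -> R) (w : plane R) : R :=
  Omega (w.1 / enorm w, w.2 / enorm w) / enorm w `^ (2 - alpha).

Definition riesz_kernel (alpha : R) (l : 'I_2) : plane R -> R :=
  frac_kernel alpha (fun u => if l == ord0 then u.1 else u.2).

(* Polar angle, in ]- pi, pi], of a point of the unit circle. *)
Definition polar_angle (u : plane R) : R :=
  if 0 <= u.2 then acos u.1 else - acos u.1.

(* The index (k, b) stands for cos ((k + 1) theta) if b = false and for
   sin ((k + 1) theta) if b = true. *)
Definition trig_kernel (alpha : R) (M : nat) (i : 'I_M * bool) : plane R -> R :=
  frac_kernel alpha (fun u =>
    let x := i.1.+1%:R * polar_angle u in if i.2 then sin x else cos x).

(* A vector of convolution operators is given by its family of kernels. *)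
Definition op_apply (I : finType) (K : I -> plane R -> R) mu (x : plane R)
    (i : I) : R :=
  \int[mu]_y K i (x - y).

(* Rintegral returns a default value on a non-integrable function, so the
   convergence of the integrals defining (T mu)(x), x in J, is stated apart. *)
Definition op_defined (I : finType) (K : I -> plane R -> R) mu J : Prop :=
  forall x, pts J x -> forall i : I,
    mu.-integrable setT (fun y => (K i (x - y))%:E).

Definition vnorm (I : finType) (v : I -> R) : R :=
  Num.sqrt (\sum_(i : I) v i ^+ 2).

Definition strong_reversal (I : finType) (K : I -> plane R -> R)
    (C0 alpha : R) J mu omega : Prop :=
  (energy_sq J omega * poisson alpha J mu ^+ 2 <=
   C0%:E * avg omega J (fun x => avg omega J (fun z =>
     ((vnorm (fun i => op_apply K mu x i - op_apply K mu z i)%R ^+ 2)%R)%:E)))%E.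

Definition strong_reversal_fails (I : finType) (K : I -> plane R -> R)
    (C0 alpha : R) J mu : Prop :=
  op_defined K mu J /\
  exists omega, [/\ locally_finite omega, (0 < omega (pts J))%E &
    ~ strong_reversal K C0 alpha J mu omega].

End Operators.

(* Main.v *)
Require Import Defs.
From mathcomp Require Import all_boot all_order all_algebra.
From mathcomp Require Import all_classical all_reals all_analysis.
From mathcomp Require Import measurable_realfun ring lra.
Import Order.TTheory GRing.Theory Num.Theory.
Import numFieldNormedType.Exports.
Local Open Scope classical_set_scope.
Local Open Scope ring_scope.

(** Let [c] be the centre of [J], [e_1] and [e_2] the coordinate vectors, and
[r = 2 - alpha > 0]. If [omega] is a sum of two Dirac masses, at [c] and at
[c + epsilon e_1], the inequality compares [epsilon ^+ 2], up to a positive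
constant, with the square of the increment of [T mu] between these two points.
It is therefore false for small [epsilon] as soon as the derivative of [T mu] at
[c] along [e_1] is zero, and the point is to find a single [mu] for which this
happens for every operator of every family.

The reason is the homogeneity of the kernels, of degree [- r], together with
their continuity off the origin. Consider a half-line with apex [A],
carrying a measure which is homogeneous of degree [r] about [A]. Its potential
is then unchanged when the observation point is moved by a homothety of centre
[A], as far as it makes sense: the potential of the infinite half-line diverges,
but if the half-line is cut off at a point [Y], moving the observation point
towards or away from [A] amounts to moving the cut-off point
([dilated_ray_potential]), so that the derivative of the potential is a boundary
term, a multiple of the kernel at [c - Y] ([is_derive_dilated_ray_potential]).

Take now two such segments, from the apices [c + h e_1] and [c - h e_1] to the
same point [Y = c + h e_2]; together they form the tent. A displacement of [c]
along [e_1] goes towards one apex and away from the other, the two boundary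
terms are opposite, and the derivative vanishes
([tent_potential_little_o]). With [h] a multiple of [gamma] times the side of
[J], the tent avoids the dilated square, and it is a finite nonzero measure, so
that its Poisson integral is positive ([poisson_tent_ge]).

It remains to see that the kernels are continuous, which is not apparent for
[cos (k theta)] and [sin (k theta)] across the jump of the polar angle: by
De Moivre's formula they are polynomials in the coordinates on the unit circle
([circle_powE]). *)

(** * The Euclidean norm and the powers of a unit complex number *)

Section PlaneLimits.
Context {R : realType}.

Lemma cvg_plane (T : Type) (F : set_system T) (FF : Filter F) (f g : T -> R)
    (a b : R) : f x @[x --> F] --> a -> g x @[x --> F] --> b ->
  (f x, g x) @[x --> F] --> ((a, b) : plane R).
Proof. by move=> fa gb; exact: (cvg_pair fa gb). Qed.

End PlaneLimits.

Section EuclideanNorm.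
Context {R : realType}.
Implicit Types w : plane R.

Lemma enorm_ge0 w : 0 <= enorm w.
Proof. exact: sqrtr_ge0. Qed.

Lemma enorm_sqr w : enorm w ^+ 2 = w.1 ^+ 2 + w.2 ^+ 2.
Proof. by rewrite sqr_sqrtr// addr_ge0// sqr_ge0. Qed.

Lemma norm_fst_le_enorm w : `|w.1| <= enorm w.
Proof. by rewrite -sqrtr_sqr ler_sqrt ?addr_ge0 ?sqr_ge0// lerDl sqr_ge0. Qed.

Lemma norm_snd_le_enorm w : `|w.2| <= enorm w.
Proof. by rewrite -sqrtr_sqr ler_sqrt ?addr_ge0 ?sqr_ge0// lerDr sqr_ge0. Qed.

Lemma enorm_le_l1 w : enorm w <= `|w.1| + `|w.2|.
Proof.
rewrite -[leRHS]ger0_norm ?addr_ge0// -sqrtr_sqr ler_sqrt ?sqr_ge0//.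
rewrite sqrrD !real_normK ?num_real//.
have : 0 <= `|w.1| * `|w.2| by rewrite mulr_ge0.
by rewrite mulr2n; lra.
Qed.

Lemma enorm_eq0 w : (enorm w == 0) = (w == 0).
Proof.
apply/idP/eqP => [/eqP w0|->]; last first.
  by rewrite /enorm/= expr0n/= addr0 sqrtr0.
have := norm_fst_le_enorm w; have := norm_snd_le_enorm w.
by case: w w0 => a b -> /=; rewrite !normr_le0 => /eqP-> /eqP->.
Qed.

Lemma enorm_gt0 w : (0 < enorm w) = (w != 0).
Proof. by rewrite lt_def enorm_ge0 andbT enorm_eq0. Qed.

Lemma enormZ (l : R) w : 0 <= l -> enorm (l * w.1, l * w.2) = l * enorm w.
Proof.
move=> l0; rewrite /enorm/= !exprMn -mulrDr sqrtrM ?sqr_ge0//.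
by rewrite sqrtr_sqr ger0_norm.
Qed.

Lemma enorm_powE w : enorm w = (w.1 ^+ 2 + w.2 ^+ 2) `^ 2^-1.
Proof. by rewrite powR12_sqrt// addr_ge0// sqr_ge0. Qed.

Lemma measurable_enorm d (T : measurableType d) (f : T -> plane R) :
  measurable_fun setT f -> measurable_fun setT (fun t => enorm (f t)).
Proof.
move=> /measurable_fun_pairP[m1 m2].
apply: (eq_measurable_fun (fun t => ((f t).1 ^+ 2 + (f t).2 ^+ 2) `^ 2^-1)).
  by move=> t _; rewrite -enorm_powE.
apply: (measurableT_comp (measurable_powR 2^-1)).
by apply: measurable_funD; exact: measurable_funX.
Qed.

Lemma continuous_enorm : continuous (@enorm R).
Proof.
move=> w; apply: continuous_comp; last exact: sqrt_continuous.
by apply: cvgD; apply: cvgM; try exact: cvg_fst; exact: cvg_snd.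
Qed.

End EuclideanNorm.

Section CirclePowers.
Context {R : realType}.

(** Real and imaginary parts of [(u.1 + i u.2)^k]. They are polynomials in the
coordinates, hence continuous across the half-line where [polar_angle] jumps,
and measurable. *)
Fixpoint circle_pow (k : nat) (u : plane R) : plane R :=
  if k is k'.+1 then
    let z := circle_pow k' u in (z.1 * u.1 - z.2 * u.2, z.2 * u.1 + z.1 * u.2)
  else (1, 0).

Lemma polar_angleK (u : plane R) : enorm u = 1 ->
  (cos (polar_angle u), sin (polar_angle u)) = u.
Proof.
case: u => a b u1.
have ab : a ^+ 2 + b ^+ 2 = 1 by rewrite -(enorm_sqr (a, b)) u1 expr1n.
have a1 : -1 <= a <= 1 by rewrite -ler_norml -u1; exact: (norm_fst_le_enorm (a, b)).
have sb : Num.sqrt (1 - a ^+ 2) = `|b|.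
  by rewrite -ab addrC addKr sqrtr_sqr.
rewrite /polar_angle/=; case: ifPn => b0.
  by rewrite acosK ?in_itv//= sin_acos// sb ger0_norm.
by rewrite cosN sinN acosK ?in_itv//= sin_acos// sb ltr0_norm ?ltNge// opprK.
Qed.

(** De Moivre's formula. *)
Lemma circle_powE (k : nat) (u : plane R) : enorm u = 1 ->
  circle_pow k u = (cos (k%:R * polar_angle u), sin (k%:R * polar_angle u)).
Proof.
move=> /polar_angleK; case: u => a b [] ea eb.
elim: k => [|k IH] /=; first by rewrite mul0r cos0 sin0.
by rewrite IH/= -natr1 mulrDl mul1r cosD sinD ea eb.
Qed.

Lemma continuous_circle_pow (k : nat) : continuous (circle_pow k).
Proof.
elim: k => [|k IH] u; first exact: cvg_cst.
have c1 : (circle_pow k x).1 @[x --> u] --> (circle_pow k u).1.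
  by apply: (cvg_comp _ _ (IH u)); exact: cvg_fst.
have c2 : (circle_pow k x).2 @[x --> u] --> (circle_pow k u).2.
  by apply: (cvg_comp _ _ (IH u)); exact: cvg_snd.
by apply: cvg_plane; [apply: cvgB|apply: cvgD]; apply: cvgM => //;
  try exact: cvg_fst; exact: cvg_snd.
Qed.

Lemma measurable_circle_pow (k : nat) : measurable_fun setT (circle_pow k).
Proof.
elim: k => [|k /measurable_fun_pairP[m1 m2]] /=; first exact: measurable_cst.
apply: measurable_fun_pair.
  by apply: measurable_funB; apply: measurable_funM.
by apply: measurable_funD; apply: measurable_funM.
Qed.

End CirclePowers.

(** * Homogeneous kernels *)

Section HomogeneousKernels.
Context {R : realType}.

(** Homogeneity of degree [- r] lets a homothety act on the potentials, and the
bound on the size makes the integrals against a finite measure converge away from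
its support. *)
Record homogeneous_kernel (r : R) (K : plane R -> R) : Prop := {
  hk_measurable : measurable_fun setT K;
  hk_continuous : forall w, w != 0 -> {for w, continuous K};
  hk_scale : forall l w, 0 < l -> K (l * w.1, l * w.2) = l `^ (- r) * K w;
  hk_bound : forall w, `|K w| <= enorm w `^ (- r) }.

Lemma unit_vector (w : plane R) : w != 0 ->
  enorm (w.1 / enorm w, w.2 / enorm w) = 1.
Proof.
rewrite -enorm_gt0 => w0.
rewrite !(mulrC _ (enorm w)^-1) enormZ ?invr_ge0 ?enorm_ge0//.
by rewrite mulVf// gt_eqF.
Qed.

(** The angular factor is evaluated on the unit circle, except at the origin where
it is multiplied by [0^-1 = 0]; a continuous extension [P] of its restriction to
the circle therefore describes the kernel everywhere. *)
Lemma frac_kernel_homogeneous (alpha : R) (Omega P : plane R -> R) :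
  alpha < 2 -> measurable_fun setT P -> continuous P ->
  (forall u, enorm u = 1 -> Omega u = P u /\ `|Omega u| <= 1) ->
  homogeneous_kernel (2 - alpha) (frac_kernel alpha Omega).
Proof.
move=> a2 mP cP OP.
have KP w : frac_kernel alpha Omega w =
    P (w.1 * enorm w `^ -1, w.2 * enorm w `^ -1) * enorm w `^ (- (2 - alpha)).
  rewrite /frac_kernel powR_inv1 ?enorm_ge0// powRN.
  have [->|w0] := eqVneq w 0; last by have [->] := OP _ (unit_vector w w0).
  have /eqP -> : enorm (0 : plane R) == 0 by rewrite enorm_eq0.
  by rewrite powR0 ?gt_eqF ?subr_gt0// invr0 !mulr0.
split.
- have mi q : measurable_fun setT (fun w : plane R => enorm w `^ q).
    by apply: (measurableT_comp (measurable_powR q)); exact: measurable_enorm.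
  rewrite (funext KP).
  apply: measurable_funM => //; apply: (measurableT_comp mP).
  by apply: measurable_fun_pair; apply: measurable_funM.
- move=> w w0.
  have ci q : {for w, continuous (fun w : plane R => enorm w `^ q)}.
    apply: (@continuous_comp _ _ _ (@enorm R) (fun x => x `^ q) w).
      exact: continuous_enorm.
    apply: differentiable_continuous; apply/derivable1_diffP.
    by apply: derivable_powR; rewrite in_itv/= andbT enorm_gt0.
  rewrite (funext KP).
  apply: cvgM; last exact: ci.
  apply: (@cvg_comp _ _ _ _ P _ (nbhs (w.1 * enorm w `^ -1, w.2 * enorm w `^ -1))); last exact: cP.
  by apply: cvg_plane; apply: cvgM; try exact: ci; [exact: cvg_fst|exact: cvg_snd].
- move=> l w l0; rewrite /frac_kernel enormZ ?ltW//= powRM ?enorm_ge0 ?ltW//.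
  have cancel x : l * x / (l * enorm w) = x / enorm w.
    by rewrite invfM mulrACA divff ?gt_eqF// mul1r.
  by rewrite !cancel powRN invfM mulrCA.
- move=> w; have [->|w0] := eqVneq w 0.
    have e0 : enorm (0 : plane R) = 0 by apply/eqP; rewrite enorm_eq0.
    by rewrite /frac_kernel e0 powR0 ?gt_eqF ?subr_gt0// invr0 mulr0 normr0 powR_ge0.
  rewrite /frac_kernel normrM normfV (ger0_norm (powR_ge0 _ _)) powRN.
  by rewrite ler_piMl ?invr_ge0 ?powR_ge0//; have [] := OP _ (unit_vector w w0).
Qed.

Lemma trig_kernel_homogeneous (alpha : R) (M : nat) (i : 'I_M * bool) :
  alpha < 2 -> homogeneous_kernel (2 - alpha) (trig_kernel alpha i).
Proof.
move=> a2; set k := i.1.+1.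
pose P u := if i.2 then (circle_pow k u).2 else (circle_pow k u : plane R).1.
apply: (@frac_kernel_homogeneous _ _ P) => //.
- by rewrite /P; case: i.2; have /measurable_fun_pairP[] := measurable_circle_pow (R := R) k.
- move=> u; rewrite /P; case: i.2.
    by apply: (@continuous_comp _ _ _ (circle_pow k) snd u (continuous_circle_pow k u)); exact: cvg_snd.
  by apply: (@continuous_comp _ _ _ (circle_pow k) fst u (continuous_circle_pow k u)); exact: cvg_fst.
- move=> u u1; rewrite /P (circle_powE _ _ u1)/= -/k.
  by case: i.2; split=> //; rewrite ler_norml ?sin_geN1 ?sin_le1 ?cos_geN1 ?cos_le1.
Qed.

Lemma riesz_kernel_homogeneous (alpha : R) (l : 'I_2) :
  alpha < 2 -> homogeneous_kernel (2 - alpha) (riesz_kernel alpha l).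
Proof.
move=> a2; pose P (u : plane R) := if l == ord0 then u.1 else u.2.
apply: (@frac_kernel_homogeneous _ _ P) => //.
- by rewrite /P; case: (l == ord0); [exact: measurable_fst|exact: measurable_snd].
- by move=> u; rewrite /P; case: (l == ord0); [exact: cvg_fst|exact: cvg_snd].
- move=> u u1; split => //; rewrite -u1.
  by case: (l == ord0); rewrite ?norm_fst_le_enorm ?norm_snd_le_enorm.
Qed.

End HomogeneousKernels.

(** * Integration against a restricted measure *)

Section RestrictedIntegral.
Local Open Scope ereal_scope.
Context d (T : measurableType d) (R : realType).
Variables (m : {measure set T -> \bar R}) (D : set T) (mD : measurable D).

Lemma integral_mrestr_dom (f : T -> \bar R) :
  \int[mrestr m mD]_(x in D) f x = \int[m]_(x in D) f x.
Proof.
by apply: eq_measure_integral => A mA AD; rewrite /= /mrestr (setIidl AD).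
Qed.

Lemma mrestr_setC0 : mrestr m mD (~` D) = 0.
Proof. by rewrite /mrestr setICl measure0. Qed.

Lemma ge0_integral_mrestr (f : T -> \bar R) :
  measurable_fun setT f -> (forall x, 0 <= f x) ->
  \int[mrestr m mD]_x f x = \int[m]_(x in D) f x.
Proof.
move=> mf f0; rewrite -integral_mrestr_dom.
rewrite (@ge0_negligible_integral _ _ _ (mrestr m mD) setT (~` D))//.
- by rewrite setTD setCK.
- exact: measurableC.
- exact: mrestr_setC0.
Qed.

Lemma integrable_mrestr (f : T -> \bar R) : measurable_fun setT f ->
  m.-integrable D f -> (mrestr m mD).-integrable setT f.
Proof.
move=> mf /integrableP[_ fi]; apply/integrableP; split=> //.
by rewrite ge0_integral_mrestr//; exact: measurableT_comp.
Qed.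

Lemma integral_mrestr (f : T -> \bar R) : measurable_fun setT f ->
  m.-integrable D f -> \int[mrestr m mD]_x f x = \int[m]_(x in D) f x.
Proof.
move=> mf fi; rewrite -integral_mrestr_dom.
rewrite (@negligible_integral _ _ _ (mrestr m mD) setT (~` D))//.
- by rewrite setTD setCK.
- exact: measurableC.
- exact: integrable_mrestr.
- exact: mrestr_setC0.
Qed.

End RestrictedIntegral.

(** * Rays and their potentials *)

Section Rays.
Context {R : realType}.
Notation leb := (@lebesgue_measure R).

(** The half-line of apex [A] and direction [D], run so that for [p = r^-1] the
image of Lebesgue measure is homogeneous of degree [r] about [A]: the homothety
of centre [A] and ratio [l] multiplies it by [l `^ - r]. *)
Definition ray (p : R) (A D : plane R) (t : R) : plane R :=
  (A.1 + t `^ p * D.1, A.2 + t `^ p * D.2).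

Lemma measurable_ray p A D : measurable_fun setT (ray p A D).
Proof.
apply: measurable_fun_pair; apply: measurable_funD => //;
  by apply: measurable_funM => //; exact: measurable_powR.
Qed.

Lemma measurable_unit_itv : measurable (`[0, 1]%classic : set R).
Proof. exact: measurable_itv. Qed.

(** Only the part of the ray between [A] and [A + D] is charged, so that the
measure is finite. *)
Definition ray_measure (p : R) (A D : plane R) : {measure set (plane R) -> \bar R}.
Proof.
refine (pushforward (mrestr leb measurable_unit_itv) (ray p A D)).
exact: measurable_ray.
Defined.

Lemma ray_measureE p A D (U : set (plane R)) :
  ray_measure p A D U = leb (ray p A D @^-1` U `&` `[0, 1]).
Proof. by []. Qed.

Lemma ge0_integral_ray_measure p A D (f : plane R -> \bar R) :
  measurable_fun setT f -> (forall y, (0 <= f y)%E) ->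
  (\int[ray_measure p A D]_y f y = \int[leb]_(t in `[0%R, 1%R]) f (ray p A D t))%E.
Proof.
move=> mf f0; have mr := measurable_ray p A D.
transitivity (\int[mrestr leb measurable_unit_itv]_(t in ray p A D @^-1` setT)
    (f \o ray p A D) t)%E; first exact: ge0_integral_pushforward.
by rewrite preimage_setT ge0_integral_mrestr//=; exact: measurableT_comp.
Qed.

Lemma integral_ray_measure p A D (f : plane R -> \bar R) :
  measurable_fun setT f -> leb.-integrable `[0, 1] (f \o ray p A D) ->
  (ray_measure p A D).-integrable setT f /\
  (\int[ray_measure p A D]_y f y = \int[leb]_(t in `[0%R, 1%R]) f (ray p A D t))%E.
Proof.
move=> mf fi; have mr := measurable_ray p A D.
have mfr : measurable_fun setT (f \o ray p A D) by exact: measurableT_comp.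
have fi' : (mrestr leb measurable_unit_itv).-integrable (ray p A D @^-1` setT) (f \o ray p A D).
  by rewrite preimage_setT; exact: integrable_mrestr.
split; first exact: integrable_pushforward.
transitivity (\int[mrestr leb measurable_unit_itv]_(t in ray p A D @^-1` setT)
    (f \o ray p A D) t)%E; first exact: integral_pushforward.
by rewrite preimage_setT integral_mrestr.
Qed.

Lemma continuous_ray (p : R) A D (t : R) : 0 < t ->
  {for t, continuous (ray p A D)}.
Proof.
move=> t0; have cp : {for t, continuous (fun t => t `^ p)}.
  apply: differentiable_continuous; apply/derivable1_diffP.
  by apply: derivable_powR; rewrite in_itv/= andbT.
by apply: cvg_plane; apply: cvgD; try exact: cvg_cst; apply: cvgM => //; exact: cvg_cst.
Qed.

Lemma cvg_ray_apex (p : R) A D : 0 < p ->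
  ray p A D t @[t --> 0^'+] --> ray p A D 0.
Proof.
move=> p0; have cp : t `^ p @[t --> (0:R)^'+] --> (0 : R) `^ p.
  by rewrite powR0 ?gt_eqF//; exact: powR_cvg0.
by apply: cvg_plane; apply: cvgD; try exact: cvg_cst; apply: cvgM => //; exact: cvg_cst.
Qed.

End Rays.

Section DilatedRay.
Context {R : realType}.
Notation leb := (@lebesgue_measure R).
Variables (r : R) (K : plane R -> R).
Hypotheses (r0 : 0 < r) (hK : homogeneous_kernel r K).
Variables w D : plane R.
Hypothesis wD : forall v, 0 <= v -> (w.1 - v * D.1, w.2 - v * D.2) != 0.

Let G (s : R) : R := K (ray r^-1 w (- D.1, - D.2) s).

Let rayN0 s : ray r^-1 w (- D.1, - D.2) s != 0.
Proof. by rewrite /ray/= !mulrN; exact/wD/powR_ge0. Qed.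

Lemma continuous_kernel_along_ray s : 0 < s -> {for s, continuous G}.
Proof.
move=> s0; apply: (@continuous_comp _ _ _ (ray r^-1 w (- D.1, - D.2)) K s).
  exact: continuous_ray.
exact: (hk_continuous _ _ hK).
Qed.

Lemma within_continuous_kernel_along_ray b : 0 < b -> {within `[0, b], continuous G}.
Proof.
move=> b0; apply/continuous_within_itvP => //; split.
- by move=> x; rewrite in_itv/= => /andP[x0 _]; exact: continuous_kernel_along_ray.
- apply: (@cvg_comp _ _ _ (ray r^-1 w (- D.1, - D.2)) K _ (nbhs (ray r^-1 w (- D.1, - D.2) 0))).
    by apply: cvg_ray_apex; rewrite invr_gt0.
  exact: (hk_continuous _ _ hK).
- by apply: cvg_at_left_filter; exact: continuous_kernel_along_ray.
Qed.

Lemma integrable_kernel_along_ray b : 0 < b -> leb.-integrable `[0, b] (EFin \o G).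
Proof.
move=> b0; apply: continuous_compact_integrable; first exact: segment_compact.
exact: within_continuous_kernel_along_ray.
Qed.

(** The left-hand side is the potential, at the point [A + l w], of the ray
measure with apex [A] and direction [D]. The homothety of ratio [l^-1] about [A]
brings this point to [A + w]; the degree [- r] of the kernel cancels the degree
[r] of the measure, and all that is left of [l] is where the ray stops. *)
Lemma dilated_ray_potential l : 0 < l ->
  \int[leb]_(t in `[0, 1])
     K (l * w.1 - t `^ r^-1 * D.1, l * w.2 - t `^ r^-1 * D.2) =
  \int[leb]_(s in `[0, l `^ (- r)]) G s.
Proof.
move=> l0; pose b := l `^ (- r); have b0 : 0 < b by exact: powR_gt0.
pose F (t : R) := b * t.
have dF : F^`()%classic = cst b.
  apply/funext => t; rewrite derive1E.
  by rewrite (@derive_val _ _ _ _ _ _ _ (is_deriveZ b (is_derive_id t 1))) /= scaler1.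
have F0 : F 0 = 0 by rewrite /F mulr0.
have F1 : F 1 = b by rewrite /F mulr1.
rewrite -/b /Rintegral -{2}F0 -F1; congr fine.
rewrite integration_by_substitution_increasing//.
- apply: eq_integral => t; rewrite inE/= in_itv/= => /andP[t0 t1].
  congr (_%:E); rewrite dF /G /F /ray !fctE /= [RHS]mulrC.
  rewrite powRM ?(ltW b0)// /b -powRrM mulNr divff ?gt_eqF// powR_inv1 ?(ltW l0)//.
  rewrite -(hk_scale _ _ hK) //=.
  by congr (K (_, _)); field; rewrite gt_eqF.
- by move=> x y _ _ xy; rewrite /F ltr_pM2l.
- by rewrite dF => x _; exact: cvg_cst.
- by rewrite dF; exact: is_cvg_cst.
- by rewrite dF; exact: is_cvg_cst.
- have cF : continuous F by move=> x; apply: mulrl_continuous.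
  split.
  + by move=> x _; apply: derivableM.
  + by apply: cvg_at_right_filter; exact: cF.
  + by apply: cvg_at_left_filter; exact: cF.
- by rewrite F0 F1; exact: within_continuous_kernel_along_ray.
Qed.

(** When the observation point moves towards or away from the apex, only the end
of the ray contributes to the variation of the potential, through the value of
the kernel there. *)
Lemma is_derive_dilated_ray_potential (k : R) :
  is_derive (0 : R) 1 (fun d : R =>
    \int[leb]_(s in `[0, (1 + k * d) `^ (- r)]) G s)
    (- r * k * K (w.1 - D.1, w.2 - D.2)).
Proof.
pose Phi (x : R) := \int[leb]_(s in `[0, x]) G s.
have dPhi : is_derive (1 : R) 1 Phi (G 1).
  have [] := @continuous_FTC1_closed R G 0 1 2 _ _ _ _ => //.
  - by rewrite ltr1n.
  - exact: integrable_kernel_along_ray.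
  - exact: continuous_kernel_along_ray.
  - by move=> h1 h2; split => //; rewrite -derive1E.
have dpow : is_derive (1 + k * 0 : R) 1 (fun x => x `^ (- r)) (- r).
  rewrite mulr0 addr0.
  have := @is_derive1_powR R (- r) 1 ltr01; by rewrite powR1 mulr1.
have dlin : is_derive (0 : R) 1 (fun d => 1 + k * d) k.
  have := is_deriveD (is_derive_cst (1 : R) (0 : R) 1)
    (is_deriveZ k (is_derive_id (0 : R) 1)).
  by rewrite add0r [X in is_derive _ _ _ X]mulr1.
have dPhi' : is_derive ((1 + k * 0) `^ (- r)) 1 Phi (G 1).
  by rewrite mulr0 addr0 powR1.
have := @is_derive1_comp _ (fun x => x `^ (- r)) (fun d => 1 + k * d) _ _ _ dpow dlin.
move=> /(@is_derive1_comp _ Phi ((fun x => x `^ (- r)) \o (fun d => 1 + k * d))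
  _ _ _ dPhi') dcomp; apply: is_derive_eq dcomp _.
by rewrite /G /ray /= powR1 !mul1r mulrC.
Qed.

End DilatedRay.

(** * Two-point measures *)

Section TwoPoints.
Import HBNNSimple.
Context {R : realType}.
Variables p q : plane R.
Hypothesis pq : p != q.

Definition two_points : {measure set (plane R) -> \bar R} :=
  measure_add (\d_ p) (\d_ q).

Lemma two_pointsE (U : set (plane R)) : two_points U = (\d_ p U + \d_ q U)%E.
Proof. exact: measure_addE. Qed.

Lemma measurable_point (a : plane R) : measurable [set a].
Proof.
have -> : [set a] = [set a.1] `*` [set a.2].
  by case: a => a b; apply/seteqP; split=> [_ ->//|[x y] [/= -> ->]].
exact: measurableX.
Qed.

Lemma nnsfun_integral_two_points (g : {nnsfun (plane R) >-> R}) :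
  sintegral two_points g = (g p + g q)%:E.
Proof.
rewrite -integralT_nnsfun.
rewrite ge0_integral_measure_add//; last 2 first.
- by move=> x _; rewrite lee_fin.
- exact/measurable_EFinP.
have mg : measurable_fun setT (EFin \o g) by exact/measurable_EFinP.
by rewrite !integral_dirac// !diracT !mul1e EFinD.
Qed.

(** The integral of a nonnegative function, measurable or not, is the supremum of
the integrals of the simple functions below it, and for [two_points] this
supremum is reached by one supported by the two points. This generality allows
averaging potentials as functions of the observation point. *)
Lemma integral_two_points (D : set (plane R)) (f : plane R -> R) :
  D p -> D q -> (forall x, 0 <= f x) ->
  (\int[two_points]_(x in D) (f x)%:E = (f p + f q)%:E)%E.
Proof.
move=> Dp Dq f0.
have fD0 x : (0 <= ((EFin \o f) \_ D) x)%E.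
  by apply: erestrict_ge0 => y _; rewrite lee_fin.
rewrite integral_mkcond ge0_integralTE//; apply/eqP; rewrite eq_le; apply/andP; split.
  apply: ge_ereal_sup => _ [g /= gf <-].
  rewrite nnsfun_integral_two_points lee_fin.
  have := gf p; have := gf q; rewrite !patchE !mem_set// !lee_fin => gq gp.
  exact: lerD.
apply: ereal_sup_ubound => /=.
pose g := add_nnsfun
  (scale_nnsfun (indic_nnsfun R (measurable_point p)) (f0 p))
  (scale_nnsfun (indic_nnsfun R (measurable_point q)) (f0 q)).
have gE x : g x = f p * (x == p)%:R + f q * (x == q)%:R.
  have s1 (a : plane R) : (x \in [set a]) = (x == a).
    by apply/idP/eqP => [|->]; rewrite inE.
  by rewrite /g /= /mindic !indicE !s1.
exists g; last first.
  rewrite nnsfun_integral_two_points !gE !eqxx (negbTE pq) eq_sym (negbTE pq).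
  by rewrite !mulr0 !mulr1 addr0 add0r.
move=> x; rewrite gE; have [->|xp] := eqVneq x p.
  by rewrite (negbTE pq) patchE mem_set// mulr0 addr0 mulr1.
have [->|xq] := eqVneq x q.
  by rewrite patchE mem_set// mulr0 add0r mulr1.
by rewrite !mulr0 addr0.
Qed.

Lemma locally_finite_two_points : locally_finite two_points.
Proof.
move=> x; exists setT; first exact: filterT.
by split=> //; rewrite two_pointsE !diracT ltry.
Qed.

End TwoPoints.
Arguments integral_two_points {R p q}.

Section TwoPointAverages.
Context {R : realType}.
Variables (J : square R) (p q : plane R).
Hypotheses (pq : p != q) (Jp : pts J p) (Jq : pts J q).

Lemma two_points_pts : two_points p q (pts J) = 2%:E.
Proof. by rewrite two_pointsE /= !diracE !mem_set. Qed.

Lemma energy_two_points :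
  energy_sq J (two_points p q) = ((enorm (p - q) / root_area J) ^+ 2 / 2)%:E.
Proof.
rewrite /energy_sq two_points_pts /=.
pose f (x z : plane R) := (enorm (x - z) / root_area J) ^+ 2.
have f0 x z : 0 <= f x z by rewrite sqr_ge0.
have -> : (fun x => \int[two_points p q]_(z in pts J) (f x z)%:E)%E =
    (fun x => (f x p + f x q)%:E).
  by apply/funext => x; rewrite (integral_two_points pq).
rewrite (integral_two_points pq)//; last by move=> x; rewrite addr_ge0.
rewrite /f.
have e0 : enorm (0 : plane R) = 0 by apply/eqP; rewrite enorm_eq0.
have -> : enorm (q - p) = enorm (p - q).
  by rewrite /enorm /= -sqrrN opprB -(sqrrN (q.2 - p.2)) opprB.
rewrite !subrr e0 mul0r expr0n /= -!EFinM; congr (_%:E).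
by set u := _ ^+ 2; field.
Qed.

Lemma avg_two_points (f : plane R -> R) : (forall x, 0 <= f x) ->
  avg (two_points p q) J (fun x => (f x)%:E) = ((f p + f q) / 2)%:E.
Proof.
move=> f0; rewrite /avg two_points_pts /= (integral_two_points pq)//.
by rewrite -EFinM mulrC.
Qed.

Lemma avg2_two_points (f : plane R -> plane R -> R) : (forall x z, 0 <= f x z) ->
  avg (two_points p q) J (fun x => avg (two_points p q) J (fun z => (f x z)%:E)) =
  ((f p p + f p q + (f q p + f q q)) / 4)%:E.
Proof.
move=> f0.
have -> : (fun x => avg (two_points p q) J (fun z => (f x z)%:E)) =
    (fun x => ((f x p + f x q) / 2)%:E).
  by apply/funext => x; rewrite avg_two_points.
rewrite avg_two_points; last by move=> x; rewrite divr_ge0// addr_ge0.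
by congr (_%:E); field.
Qed.

End TwoPointAverages.

(** * The tent *)

Section Tent.
Context {R : realType}.
Notation leb := (@lebesgue_measure R).
Variables (r : R) (c : plane R) (h : R).
Hypotheses (r0 : 0 < r) (h0 : 0 < h).

(** For [e = 1] and [e = -1], the segment joining [c + e h e_1] to the common
summit [c + h e_2], where [e_1] and [e_2] are the coordinate vectors. *)
Definition arm (e : R) : R -> plane R :=
  ray r^-1 (c.1 + e * h, c.2) (- (e * h), h).

Definition arm_measure (e : R) : {measure set (plane R) -> \bar R} :=
  ray_measure r^-1 (c.1 + e * h, c.2) (- (e * h), h).

Definition tent : {measure set (plane R) -> \bar R} :=
  measure_add (arm_measure 1) (arm_measure (-1)).

Lemma arm_param (t : R) : 0 <= t <= 1 -> 0 <= t `^ r^-1 <= 1.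
Proof.
move=> /andP[t0 t1]; rewrite powR_ge0/=.
have -> : 1 = 1 `^ r^-1 :> R by rewrite powR1.
by rewrite ge0_ler_powR ?nnegrE// invr_ge0 ltW.
Qed.

Lemma arm_far (e t : R) : `|e| = 1 -> 0 <= t <= 1 ->
  h / 2 <= `|(arm e t).1 - c.1| \/ h / 2 <= `|(arm e t).2 - c.2|.
Proof.
move=> e1 /arm_param; rewrite /arm /ray /=; set v := t `^ _ => /andP[v0 v1].
have -> : c.1 + e * h + v * - (e * h) - c.1 = e * (h * (1 - v)) by ring.
have -> : c.2 + v * h - c.2 = h * v by ring.
rewrite normrM e1 mul1r !ger0_norm ?mulr_ge0 ?subr_ge0 ?(ltW h0)//.
by rewrite !ler_pM2l//; have [v2|v2] := leP v 2^-1; [left|right]; lra.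
Qed.

Lemma arm_near (e t : R) : `|e| = 1 -> 0 <= t <= 1 -> enorm (arm e t - c) <= h.
Proof.
move=> e1 /arm_param; rewrite /arm /ray; set v := t `^ _ => /andP[v0 v1].
apply: (le_trans (enorm_le_l1 _)) => /=.
have -> : c.1 + e * h + v * - (e * h) - c.1 = e * (h * (1 - v)) by ring.
have -> : c.2 + v * h - c.2 = h * v by ring.
rewrite normrM e1 mul1r !ger0_norm ?mulr_ge0 ?subr_ge0 ?(ltW h0)//.
by rewrite -mulrDr subrK mulr1.
Qed.

Definition near_center (x : plane R) : Prop :=
  `|x.1 - c.1| <= h / 4 /\ `|x.2 - c.2| <= h / 4.

Lemma arm_separated (e t : R) (x : plane R) : `|e| = 1 -> 0 <= t <= 1 ->
  near_center x -> h / 4 <= enorm (x - arm e t).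
Proof.
move=> e1 t01 [x1 x2].
have [y1|y2] := arm_far e t e1 t01.
  apply: le_trans (norm_fst_le_enorm _) => /=.
  have := ler_normD ((arm e t).1 - x.1) (x.1 - c.1).
  by rewrite subrKA (distrC _ x.1); lra.
apply: le_trans (norm_snd_le_enorm _) => /=.
have := ler_normD ((arm e t).2 - x.2) (x.2 - c.2).
by rewrite subrKA (distrC _ x.2); lra.
Qed.

Section Potential.
Variable K : plane R -> R.
Hypothesis hK : homogeneous_kernel r K.

Lemma measurable_translated_kernel (x : plane R) :
  measurable_fun setT (fun y : plane R => K (x - y)).
Proof.
apply: (measurableT_comp (hk_measurable _ _ hK)).
by apply: measurable_fun_pair; apply: measurable_funB.
Qed.

Lemma arm_potential (e : R) (x : plane R) : `|e| = 1 -> near_center x ->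
  (arm_measure e).-integrable setT (fun y : plane R => (K (x - y))%:E) /\
  (\int[arm_measure e]_y (K (x - y))%:E =
   \int[leb]_(t in `[0%R, 1%R]) (K (x - arm e t)%R)%:E)%E.
Proof.
move=> e1 xc.
apply: (integral_ray_measure _ _ _ (fun y : plane R => (K (x - y))%:E)).
  by apply/measurable_EFinP; exact: measurable_translated_kernel.
apply: (@measurable_bounded_integrable _ _ _ leb (fun t => K (x - arm e t))).
- exact: measurable_itv.
- by rewrite /= lebesgue_measure_itv/= lte01 sube0 ltry.
- apply: (measurable_funS measurableT) => //.
  apply: (measurableT_comp (measurable_translated_kernel x)).
  exact: measurable_ray.
- exists ((h / 4) `^ (- r)); split; first by rewrite num_real.
  move=> M ltM t /=; rewrite in_itv/= => t01; apply: le_trans (ltW ltM).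
  apply: (le_trans (hk_bound _ _ hK _)).
  have h4 : 0 < h / 4 by rewrite divr_gt0.
  have sep := arm_separated e t x e1 t01 xc.
  rewrite !powRN lef_pV2 ?posrE ?powR_gt0//; last exact: lt_le_trans sep.
  by rewrite ge0_ler_powR ?nnegrE ?enorm_ge0// ltW.
Qed.

Lemma tent_integrable (x : plane R) : near_center x ->
  tent.-integrable setT (fun y : plane R => (K (x - y))%:E).
Proof.
move=> xc.
have [/integrableP[mf i1] _] := arm_potential 1 x (normr1 _) xc.
have [/integrableP[_ i2] _] := arm_potential (-1) x (normrN1 _) xc.
apply/integrableP; split => //.
rewrite ge0_integral_measure_add//; last exact: measurableT_comp.
exact: lte_add_pinfty.
Qed.

Lemma tent_potential (x : plane R) : near_center x ->
  \int[tent]_y K (x - y) =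
  \int[leb]_(t in `[0, 1]) K (x - arm 1 t) +
  \int[leb]_(t in `[0, 1]) K (x - arm (-1) t).
Proof.
move=> xc.
have [i1 e1] := arm_potential 1 x (normr1 _) xc.
have [i2 e2] := arm_potential (-1) x (normrN1 _) xc.
rewrite /Rintegral integral_measure_add//.
by rewrite fineD ?e1 ?e2//; [rewrite -e1|rewrite -e2]; exact: integrable_fin_num.
Qed.

Let shifted (d : R) : plane R := (c.1 + h * d, c.2).

Lemma near_center_shifted d : `|d| <= 4^-1 -> near_center (shifted d).
Proof.
move=> d4; rewrite /near_center /= addrAC subrr add0r normrM (gtr0_norm h0).
by rewrite subrr normr0 ler_pM2l//; split=> //; rewrite divr_ge0// ltW.
Qed.

Let G (e s : R) : R := K (ray r^-1 (- (e * h), 0) (- - (e * h), - h) s).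

Lemma arm_avoids_center e v : `|e| = 1 -> 0 <= v ->
  (- (e * h) - v * - (e * h), 0 - v * h) != 0 :> plane R.
Proof.
move=> e1 v0; apply/eqP => -[w1 w2].
have v00 : v = 0.
  by apply/eqP; move/eqP: w2; rewrite sub0r oppr_eq0 mulf_eq0 (gt_eqF h0) orbF.
move/eqP: w1; rewrite v00 mul0r subr0 oppr_eq0 mulf_eq0 (gt_eqF h0) orbF.
by rewrite -normr_eq0 e1 oner_eq0.
Qed.

Lemma arm_potential_shifted e d : `|e| = 1 -> `|d| <= 4^-1 ->
  \int[leb]_(t in `[0, 1]) K (shifted d - arm e t) =
  \int[leb]_(s in `[0, (1 + - e * d) `^ (- r)]) G e s.
Proof.
move=> e1 d4.
have ed : `|e * d| <= 4^-1 by rewrite normrM e1 mul1r.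
have l0 : 0 < 1 + - e * d by move: ed; rewrite ler_norml mulNr; lra.
have ee : e * e = 1 by rewrite -expr2 -real_normK ?num_real// e1 expr1n.
have wD v := arm_avoids_center e v e1.
have := dilated_ray_potential _ _ r0 hK (- (e * h), 0) (- (e * h), h) wD _ l0.
move=> /= <-.
apply: eq_Rintegral => t _; congr (K (_, _)) => /=; last by ring.
have -> : (1 + - e * d) * - (e * h) = e * e * (d * h) - e * h by ring.
by rewrite ee; ring.
Qed.

Lemma is_derive_tent_potential :
  is_derive (0 : R) 1 (fun d =>
    \int[leb]_(s in `[0, (1 + - 1 * d) `^ (- r)]) G 1 s +
    \int[leb]_(s in `[0, (1 + - -1 * d) `^ (- r)]) G (-1) s) 0.
Proof.
have wD e v : `|e| = 1 -> 0 <= v ->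
    (- (e * h) - v * - (e * h), 0 - v * h) != 0 :> plane R.
  by move=> e1; exact: arm_avoids_center.
have d1 := is_derive_dilated_ray_potential _ _ r0 hK (- (1 * h), 0) (- (1 * h), h)
  (fun v => wD 1 v (normr1 _)) (- 1).
have d2 := is_derive_dilated_ray_potential _ _ r0 hK (- (-1 * h), 0) (- (-1 * h), h)
  (fun v => wD (-1) v (normrN1 _)) (- -1).
apply: (is_derive_eq (is_deriveD d1 d2)) => /=.
by rewrite !subrr; ring.
Qed.

(** The two arms stop at the same summit [c + h e_2], so the boundary terms are
the same value of the kernel; as the moving point approaches the apex of one arm
while it recedes from that of the other, they carry opposite signs and the
derivative of the potential at [c] along [e_1] vanishes. *)
Lemma tent_potential_little_o (eta : R) : 0 < eta ->
  \forall d \near (0 : R)^'+,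
    `|\int[tent]_y K (shifted d - y) - \int[tent]_y K (c - y)| <= eta * d.
Proof.
move=> eta0; have dPsi := is_derive_tent_potential.
set Psi := (X in is_derive _ _ X _) in dPsi.
have tentE d : `|d| <= 4^-1 -> \int[tent]_y K (shifted d - y) = Psi d.
  move=> d4; rewrite tent_potential; last exact: near_center_shifted.
  by rewrite !arm_potential_shifted// ?normrN1 ?normr1.
have -> : c = shifted 0 by rewrite /shifted mulr0 addr0; case: c.
rewrite (tentE 0) ?normr0 ?invr_ge0//.
have [dv vPsi] := dPsi.
move: vPsi; rewrite /derive => vPsi.
move: dv; rewrite /derivable vPsi => /cvg_dnbhs_at_right cPsi.
have d14 : 0 < 4^-1 :> R by rewrite invr_gt0.
near=> d.
have d0 : 0 < d by near: d; exact: nbhs_right_gt.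
have d4 : `|d| <= 4^-1 by rewrite gtr0_norm//; near: d; exact: nbhs_right_le.
rewrite tentE//.
have : `|d^-1 *: ((Psi \o shift 0) (d *: (1 : R)) - Psi 0)| <= eta.
  by near: d; exact: cvgr0_norm_le cPsi _ eta0.
rewrite /= addr0 [d *: 1]mulr1 normrZ gtr0_norm ?invr_gt0//.
by rewrite ler_pdivrMl// mulrC.
Unshelve. all: by end_near. Qed.

End Potential.
End Tent.

(** * Squares and boxes *)

Section SquareGeometry.
Context {R : realType}.
Implicit Types (c x : plane R) (s t : R).
Notation leb := (@lebesgue_measure R).

Definition box c s : set (plane R) :=
  `[c.1 - s, c.1 + s] `*` `[c.2 - s, c.2 + s].

Lemma boxP c s x : box c s x <-> `|x.1 - c.1| <= s /\ `|x.2 - c.2| <= s.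
Proof. by rewrite /box /= !in_itv/= !ler_distl. Qed.

Lemma square_set_box c s t x : square_set c s t x -> box c s x.
Proof.
move=> [xa xb]; apply/boxP; set u := x.1 - c.1 in xa xb *.
set v := x.2 - c.2 in xa xb *.
set a := u * cos t + v * sin t in xa; set b := v * cos t - u * sin t in xb.
have uE : u = a * cos t - b * sin t.
  by rewrite -[LHS]mulr1 -(cos2Dsin2 t) /a /b; ring.
have vE : v = a * sin t + b * cos t.
  by rewrite -[LHS]mulr1 -(cos2Dsin2 t) /a /b; ring.
have c1 : `|cos t| <= 1 by rewrite ler_norml cos_geN1 cos_le1.
have s1 : `|sin t| <= 1 by rewrite ler_norml sin_geN1 sin_le1.
have le y z : `|y| <= s / 2 -> `|z| <= 1 -> `|y * z| <= s / 2.
  by move=> ys z1; rewrite normrM -[leRHS]mulr1 ler_pM.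
split; rewrite ?uE ?vE (splitr s).
  by apply: (le_trans (ler_normB _ _)); rewrite lerD// le.
by apply: (le_trans (ler_normD _ _)); rewrite lerD// le.
Qed.

Lemma box_square_set c s t x : box c (s / 4) x -> square_set c s t x.
Proof.
move=> /boxP; set u := x.1 - c.1; set v := x.2 - c.2 => -[us vs].
have c1 : `|cos t| <= 1 by rewrite ler_norml cos_geN1 cos_le1.
have s1 : `|sin t| <= 1 by rewrite ler_norml sin_geN1 sin_le1.
have le y z : `|y| <= s / 4 -> `|z| <= 1 -> `|y * z| <= s / 4.
  by move=> ys z1; rewrite normrM -[leRHS]mulr1 ler_pM.
rewrite /square_set /= -/u -/v (_ : s / 2 = s / 4 + s / 4); last by field.
split.
  by apply: (le_trans (ler_normD _ _)); rewrite lerD// le.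
by apply: (le_trans (ler_normB _ _)); rewrite lerD// le.
Qed.

Lemma measurable_box c s : measurable (box c s).
Proof. by apply: measurableX; exact: measurable_itv. Qed.

Lemma lebesgue_box c s : 0 < s ->
  (leb \x leb)%E (box c s) = ((2 * s) ^+ 2)%:E.
Proof.
move=> s0; rewrite product_measure1E; [|exact: measurable_itv..].
have len a : leb `[a - s, a + s] = (2 * s)%:E.
  by rewrite lebesgue_measure_itv/= lte_fin ltrD2l gtrN// -EFinB; congr (_%:E); ring.
transitivity ((2 * s)%:E * (2 * s)%:E)%E => //; congr (_ * _)%E; exact: len.
Qed.

Lemma measurable_square_set c s t : measurable (square_set c s t).
Proof.
have m (f : plane R -> R) : measurable_fun setT f ->
    measurable [set x | `|f x| <= s / 2].
  move=> mf; rewrite -[X in measurable X]setTI.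
  have -> : [set x | `|f x| <= s / 2] = (fun x => `|f x|) @^-1` `]-oo, s / 2].
    by apply/seteqP; split=> x /=; rewrite in_itv.
  by apply: (measurableT_comp (@normr_measurable R setT) mf); [exact: measurableT|exact: measurable_itv].
have m1 : measurable_fun setT (fun x : plane R => x.1 - c.1) by apply: measurable_funB.
have m2 : measurable_fun setT (fun x : plane R => x.2 - c.2) by apply: measurable_funB.
apply: measurableI; apply: m.
  by apply: measurable_funD; apply: measurable_funM.
by apply: measurable_funB; apply: measurable_funM.
Qed.

(** Comparison with two boxes with sides parallel to the axes shows that the area
of a tilted square is positive and finite. *)
Lemma root_area_gt0 (J : square R) : 0 < root_area J.
Proof.
have s0 : 0 < side J by exact: side_gt0.
rewrite /root_area sqrtr_gt0 /area.
have lo : (((2 * (side J / 4)) ^+ 2)%:E <= (leb \x leb)%E (pts J))%E.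
  rewrite -(lebesgue_box (Defs.center J)) ?divr_gt0//.
  apply: le_measure; rewrite ?inE.
  - exact: measurable_box.
  - exact: measurable_square_set.
  - by move=> x; exact: box_square_set.
have hi : ((leb \x leb)%E (pts J) <= ((2 * side J) ^+ 2)%:E)%E.
  rewrite -(lebesgue_box (Defs.center J))//.
  apply: le_measure; rewrite ?inE.
  - exact: measurable_square_set.
  - exact: measurable_box.
  - by move=> x; exact: square_set_box.
apply: fine_gt0; apply/andP; split.
  by apply: lt_le_trans lo; rewrite lte_fin exprn_gt0// mulr_gt0// divr_gt0.
by apply: le_lt_trans hi _; rewrite ltry.
Qed.

End SquareGeometry.

(** * Failure of the strong reversal of energy *)

Section TentMeasure.
Context {R : realType}.
Variables (r : R) (c : plane R) (h : R).
Hypotheses (r0 : 0 < r) (h0 : 0 < h).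

Lemma arm_measure_le1 e U : measurable U -> (arm_measure r c h e U <= 1)%E.
Proof.
move=> mU; rewrite /arm_measure ray_measureE.
rewrite -[leRHS](_ : lebesgue_measure `[(0:R), 1] = 1%E); last first.
  by rewrite lebesgue_measure_itv/= lte01 sube0.
apply: le_measure; rewrite ?inE; last exact: subIsetr.
  apply: measurableI; last exact: measurable_itv.
  by rewrite -[X in measurable X]setTI; exact: measurable_ray.
exact: measurable_itv.
Qed.

Lemma tentE U :
  tent r c h U = (arm_measure r c h 1 U + arm_measure r c h (-1) U)%E.
Proof. exact: measure_addE. Qed.

Lemma locally_finite_tent : locally_finite (tent r c h).
Proof.
move=> x; exists setT; first exact: filterT.
split=> //; rewrite tentE.
by apply: lte_add_pinfty; apply: le_lt_trans (arm_measure_le1 _ _ measurableT) _; rewrite ltry.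
Qed.

Lemma arm_measure_box0 e s : `|e| = 1 -> s < h / 2 ->
  arm_measure r c h e (box c s) = 0%E.
Proof.
move=> e1 sh; rewrite /arm_measure ray_measureE.
rewrite (_ : _ `&` _ = set0) ?measure0//.
apply/seteqP; split=> // t [/boxP[y1 y2]]; rewrite /= in_itv/= => t01.
have [] := arm_far r c h r0 h0 e t e1 t01.
  by move=> /(le_lt_trans y1 \o lt_le_trans sh); rewrite ltxx.
by move=> /(le_lt_trans y2 \o lt_le_trans sh); rewrite ltxx.
Qed.

Lemma msupport_tent s : s < h / 2 -> msupport (tent r c h) `&` box c s = set0.
Proof.
move=> sh; apply/seteqP; split=> // x [+ /boxP[x1 x2]].
(* A slightly larger box is needed to surround [x] by an open null set. *)
pose s' := (s + h / 2) / 2.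
have ss' : s < s' by rewrite /s'; lra.
have s'h : s' < h / 2 by rewrite /s'; lra.
pose U : set (plane R) := `]c.1 - s', c.1 + s'[ `*` `]c.2 - s', c.2 + s'[.
have Ubox : U `<=` box c s'.
  by move=> y [/=]; rewrite !in_itv/= => /andP[? ?] /andP[? ?]; split; rewrite /= in_itv/= !ltW.
have oU : open U.
  rewrite openE => y [y1 y2].
  exists (`]c.1 - s', c.1 + s'[%classic, `]c.2 - s', c.2 + s'[%classic) => //.
  by split; apply: open_nbhs_nbhs; split=> //; exact: interval_open.
have Ux : U x.
  by split; rewrite /= in_itv/= -ltr_distl (le_lt_trans _ ss').
move=> /(_ U oU Ux); apply/negP; rewrite -leNgt.
rewrite -[leRHS](_ : tent r c h (box c s') = 0%E).
  apply: le_measure => //; rewrite inE; last exact: measurable_box.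
  by apply: measurableX; exact: measurable_itv.
by rewrite tentE !arm_measure_box0 ?normrN1 ?normr1 ?adde0.
Qed.

Lemma poisson_tent_ge (J : square R) (alpha : R) : alpha < 3 -> c = Defs.center J ->
  ((root_area J / (root_area J + h) `^ (3 - alpha))%:E <=
   poisson alpha J (tent r c h))%E.
Proof.
move=> a3 cE; have rho0 := root_area_gt0 J; set rho := root_area J in rho0 *.
pose f (y : plane R) := rho / (rho + enorm (y - Defs.center J)) `^ (3 - alpha).
have f0 y : 0 <= f y by rewrite divr_ge0 ?powR_ge0// ltW.
have mf : measurable_fun setT f.
  rewrite (_ : f = fun y => rho * (rho + enorm (y - Defs.center J)) `^ (- (3 - alpha))).
    apply: measurable_funM => //.
    apply: (measurableT_comp (measurable_powR _)); apply: measurable_funD => //.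
    by apply: measurable_enorm; apply: measurable_fun_pair; apply: measurable_funB.
  by apply/funext => y; rewrite powRN.
have mEf : measurable_fun setT (EFin \o f) by exact/measurable_EFinP.
rewrite /poisson -/rho.
rewrite [leRHS](@ge0_integral_measure_add _ _ _ (arm_measure r c h 1) (arm_measure r c h (-1))
  setT _ (EFin \o f))//; last by move=> y _; rewrite lee_fin.
rewrite -[leLHS]adde0; apply: leeD; last by apply: integral_ge0 => y _; rewrite lee_fin.
rewrite ge0_integral_ray_measure//.
set k := rho / _.
have -> : k%:E = (\int[lebesgue_measure]_(t in `[0%R, 1%R]) (cst k%:E t))%E.
  rewrite integral_cst ?measurable_itv//= lebesgue_measure_itv/= lte01 sube0.
  by rewrite mule1.
apply: ge0_le_integral => //.
- by move=> t _; rewrite lee_fin divr_ge0 ?powR_ge0// ltW.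
- apply: (measurable_funS measurableT) => //.
  by apply: (measurableT_comp mEf); exact: measurable_ray.
move=> t /=; rewrite in_itv/= => t01; rewrite lee_fin /k /f.
have rhoE (x : R) : 0 <= x -> 0 < rho + x by move=> x0; rewrite ltr_pwDl.
rewrite ler_pM2l// lef_pV2 ?posrE ?powR_gt0 ?rhoE ?enorm_ge0 ?(ltW h0)//.
apply: ge0_ler_powR.
- by rewrite subr_ge0 ltW.
- by rewrite nnegrE ltW// rhoE// enorm_ge0.
- by rewrite nnegrE ltW// rhoE// ltW.
by rewrite lerD2l -cE; exact: (arm_near r c h r0 h0 1 t (normr1 _) t01).
Qed.

End TentMeasure.

Section StrongReversalFails.
Context {R : realType}.
Variables (J : square R) (alpha h : R).
Hypotheses (a2 : alpha < 2) (hJ : 4 * side J <= h).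
Let c := Defs.center J.
Let mu := tent (2 - alpha) c h.
Let r0 : 0 < 2 - alpha. Proof. by rewrite subr_gt0. Qed.
Let s0 : 0 < side J. Proof. exact: side_gt0. Qed.
Let h0 : 0 < h. Proof. by apply: lt_le_trans hJ; rewrite mulr_gt0. Qed.

Lemma tent_op_defined (I : finType) (K : I -> plane R -> R) :
  (forall i, homogeneous_kernel (2 - alpha) (K i)) -> op_defined K mu J.
Proof.
move=> hK x /square_set_box/boxP[x1 x2] i.
apply: (tent_integrable _ _ _ r0 h0 _ (hK i)).
by split; [apply: le_trans x1 _|apply: le_trans x2 _]; rewrite ler_pdivlMr// mulrC.
Qed.

(** The two points are the centre [c] and [c + h d e_1] with [d] small. The left
side of the inequality is at least a constant times [d ^+ 2], the right side is
[C0 / 2] times the square of the increment of the potentials, hence negligible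
before [d ^+ 2]. The choice of [d] depends on the family [K], but the measure
does not. *)
Lemma strong_reversal_fails_tent (I : finType) (K : I -> plane R -> R) (C0 : R) :
  0 < C0 -> (forall i, homogeneous_kernel (2 - alpha) (K i)) ->
  strong_reversal_fails K C0 alpha J mu.
Proof.
move=> C00 hK; split; first exact: tent_op_defined.
have rho0 := root_area_gt0 J; set rho := root_area J in rho0.
pose P0 := rho / (rho + h) `^ (3 - alpha).
have P00 : 0 < P0 by rewrite divr_gt0// powR_gt0// addr_gt0.
have P0le : (P0%:E <= poisson alpha J mu)%E.
  by apply: poisson_tent_ge => //; apply: lt_trans a2 _; rewrite ltr_nat.
pose B := h * P0 / rho.
have B0 : 0 < B by rewrite divr_gt0// mulr_gt0.
pose k := C0 * #|I|%:R.
have k0 : 0 <= k by rewrite mulr_ge0// ltW.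
pose eta := B / (1 + k).
have eta0 : 0 < eta by rewrite divr_gt0// ltr_pwDl.
have keta : k * eta ^+ 2 < B ^+ 2.
  rewrite /eta expr_div_n mulrCA gtr_pMr ?exprn_gt0//.
  by rewrite ltr_pdivrMr ?exprn_gt0 ?ltr_pwDl// mul1r sqrrD; nra.
have [d [d0 dJ small]] : exists d, [/\ 0 < d, h * d <= side J / 4 &
    forall i, `|\int[mu]_y K i ((c.1 + h * d, c.2) - y) - \int[mu]_y K i (c - y)|
      <= eta * d].
  have dn : \forall d \near (0 : R)^'+, forall i,
     `|\int[mu]_y K i ((c.1 + h * d, c.2) - y) - \int[mu]_y K i (c - y)|
      <= eta * d.
    apply: filter_forall => i.
    exact: (tent_potential_little_o _ _ _ r0 h0 _ (hK i)).
  near (0 : R)^'+ => d; exists d; split.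
  - by near: d; exact: nbhs_right_gt.
  - rewrite mulrC -ler_pdivlMr//; near: d; apply: nbhs_right_le.
    by rewrite !divr_gt0.
  - by near: d.
pose q : plane R := (c.1 + h * d, c.2).
have cq : c != q.
  apply/eqP => /(congr1 fst)/eqP /=; rewrite -subr_eq0 opprD addNKr oppr_eq0.
  by rewrite gt_eqF// mulr_gt0.
have Jc : pts J c.
  by apply: box_square_set; apply/boxP; rewrite !subrr !normr0 !divr_ge0// ltW.
have Jq : pts J q.
  apply: box_square_set; apply/boxP; rewrite /q /= addrAC !subrr add0r normr0.
  by rewrite gtr0_norm ?mulr_gt0// divr_ge0// ltW.
exists (two_points c q); split.
- exact: locally_finite_two_points.
- by rewrite two_points_pts ?lte_fin.
rewrite /strong_reversal energy_two_points//.
pose V (x z : plane R) := vnorm (fun i => op_apply K mu x i - op_apply K mu z i) ^+ 2.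
have VE x z : V x z = \sum_i (op_apply K mu x i - op_apply K mu z i) ^+ 2.
  by rewrite /V /vnorm sqr_sqrtr// sumr_ge0// => i _; rewrite sqr_ge0.
rewrite (avg2_two_points _ _ _ cq Jc Jq V); last by move=> x z; rewrite /V sqr_ge0.
have V0 x : V x x = 0.
  by rewrite VE big1// => i _; rewrite subrr expr0n.
have Vsym : V c q = V q c.
  by rewrite !VE; apply: eq_bigr => i _; rewrite -sqrrN opprB.
have Vle : V q c <= #|I|%:R * (eta * d) ^+ 2.
  rewrite VE mulr_natl -sumr_const; apply: ler_sum => i _.
  have ed0 : 0 <= eta * d by rewrite mulr_ge0// ltW.
  by rewrite -[leLHS]real_normK ?num_real// ler_sqr ?nnegrE//; exact: small.
rewrite !V0 Vsym -EFinM.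
have eE : enorm (c - q) = h * d.
  rewrite /enorm /q /= opprD addNKr subrr expr0n addr0 sqrrN sqrtr_sqr gtr0_norm//.
  exact: mulr_gt0.
rewrite eE -/rho; apply/negP; rewrite -ltNge.
apply: (@lt_le_trans _ _ ((h * d / rho) ^+ 2 / 2 * P0 ^+ 2)%:E).
  rewrite lte_fin add0r addr0.
  have : C0 * V q c < (B * d) ^+ 2.
    apply: (@le_lt_trans _ _ (k * eta ^+ 2 * d ^+ 2)).
      have -> : k * eta ^+ 2 * d ^+ 2 = C0 * (#|I|%:R * (eta * d) ^+ 2).
        by rewrite /k; ring.
      by rewrite ler_pM2l.
    have -> : (B * d) ^+ 2 = B ^+ 2 * d ^+ 2 by ring.
    by rewrite ltr_pM2r// exprn_gt0.
  have -> : (B * d) ^+ 2 = (h * d / rho) ^+ 2 * P0 ^+ 2.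
    by rewrite /B; field; rewrite gt_eqF.
  lra.
rewrite EFinM; apply: lee_pmul => //.
- by rewrite lee_fin divr_ge0// sqr_ge0.
- by rewrite lee_fin sqr_ge0.
- rewrite EFin_expe !expe2.
  by apply: lee_pmul; rewrite // lee_fin ltW.
Unshelve. all: by end_near. Qed.

End StrongReversalFails.

Theorem lemma2 (R : realType) (J : square R) (alpha : R) :
  0 <= alpha -> alpha < 2 ->
  exists mu : R -> {measure set (plane R) -> \bar R},
  forall C0 : R, 0 < C0 ->
  exists gamma0 : R, forall gamma : R, 2 < gamma -> gamma0 <= gamma ->
    [/\ locally_finite (mu gamma),
        msupport (mu gamma) `&` dilate gamma J = set0,
        strong_reversal_fails (riesz_kernel alpha) C0 alpha J (mu gamma) &
        forall M : nat, (1 <= M)%N ->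
          strong_reversal_fails (@trig_kernel R alpha M) C0 alpha J (mu gamma)].
Proof.
move=> _ a2.
(* The tent stays outside the box of half-side [2 * gamma * side J] about the
centre, while the dilated square is in the box of half-side [gamma * side J]. *)
exists (fun gamma => tent (2 - alpha) (Defs.center J) (4 * gamma * side J)).
move=> C0 C00; exists 0 => gamma gamma2 _.
have s0 : 0 < side J by exact: side_gt0.
have g0 : 0 < gamma by apply: lt_trans gamma2.
have r0 : 0 < 2 - alpha by rewrite subr_gt0.
have h0 : 0 < 4 * gamma * side J by rewrite !mulr_gt0.
have hJ : 4 * side J <= 4 * gamma * side J by rewrite ler_pM2r//; lra.
split.
- exact: locally_finite_tent.
- have sub : dilate gamma J `<=` box (Defs.center J) (gamma * side J).
    by move=> x; exact: square_set_box.
  apply/seteqP; split=> // x [supp_x /sub box_x].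
  have <- := msupport_tent _ (Defs.center J) _ r0 h0 (gamma * side J) _.
    by split.
  have := mulr_gt0 g0 s0.
  have -> : 4 * gamma * side J = 4 * (gamma * side J) by ring.
  lra.
- by apply: strong_reversal_fails_tent => // l; exact: riesz_kernel_homogeneous.
- move=> M _; apply: strong_reversal_fails_tent => // i.
  exact: trig_kernel_homogeneous.
Qed.
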